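(* Let $Y=(Y_1,\dots,Y_m)$ be a random vector with independent nonnegative coordinates. For any $\ell\in\{1,\dots,m\}$, $$\mathbb{E}[\mathrm{Top}_\ell(Y)]\;\le\;\gamma_\ell(Y)\;\le\;4\,\mathbb{E}[\mathrm{Top}_\ell(Y)],\qquad\text{where }\ \gamma_\ell(Y):=\int_0^\infty \min\bigl\{\ell,\ \mathbb{E}[N^{>\theta}(Y)]\bigr\}\,d\theta .$$
   Context: $\mathrm{Top}_\ell(x)$ is the sum of the $\ell$ largest coordinates of $x\in\mathbb{R}^m_{\ge0}$. For $\theta\ge0$, $N^{>\theta}(Y)$ denotes the (random) number of coordinates $i$ with $Y_i>\theta$. *)

(* Defs.v *)
From HB Require Import structures.
From mathcomp Require Import all_boot all_order all_algebra.
From mathcomp Require Import all_classical all_reals all_analysis.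
Set Implicit Arguments.
Unset Strict Implicit.
Unset Printing Implicit Defensive.
Import Order.TTheory GRing.Theory Num.Theory.
Import numFieldNormedType.Exports.
Local Open Scope classical_set_scope.
Local Open Scope ring_scope.

Definition Top {R : realType} {m : nat} (l : nat) (x : 'I_m -> R) : R :=
  \sum_(y <- take l (sort >=%O [seq x i | i <- enum 'I_m])) y.

Definition Ngt {R : realType} {m : nat} (theta : R) (x : 'I_m -> R) : nat :=
  #|[set i : 'I_m | theta < x i]%SET|.

(* Mutual, not merely pairwise, independence. *)
Definition independent_RVs {R : realType} {d : measure_display}
    {T : measurableType d} (P : probability T R) {m : nat}
    (Y : 'I_m -> {RV P >-> R}) : Prop :=
  forall (J : {set 'I_m}) (B : 'I_m -> set R),
    (forall i, measurable (B i)) ->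
    P [set w | forall i, i \in J -> B i (Y i w)] =
    (\prod_(i in J) P (Y i @^-1` B i))%E.

(* No integrability is assumed on [Y], so the value may be [+oo]. *)
Definition gamma {R : realType} {d : measure_display}
    {T : measurableType d} (P : probability T R) {m : nat}
    (Y : 'I_m -> {RV P >-> R}) (l : nat) : \bar R :=
  (\int[@lebesgue_measure R]_(theta in `[0%R, +oo[)
     Order.min l%:R%:E
       'E_P[(fun w => (Ngt theta (fun i => Y i w))%:R)])%E.

(* Main.v *)
(** Writing [Top_l x] as the integral over [t >= 0] of [min l (N^{>t} x)]
    (layer cake) and exchanging integral and expectation, both inequalities
    reduce to comparing [min l (E N)] with [E (min l N)] at a fixed threshold,
    where [N] is a sum of independent indicators with mean [mu].  Jensen's
    inequality gives [E (min l N) <= min l mu].  Conversely, put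
    [a = min l mu / mu] and integrate the pointwise bound
    [a N - a^2 N^2 / (4 l) <= min l N]: pairwise independence yields
    [E N^2 <= mu + mu^2], and since [1 <= l] the left-hand side has mean at
    least [min l mu / 2].  So the constant 4 can even be replaced by 2. *)
Require Import Defs.
From HB Require Import structures.
From mathcomp Require Import all_boot all_order all_algebra.
From mathcomp Require Import all_classical all_reals all_analysis.
From mathcomp Require Import measurable_realfun ring lra.
Set Implicit Arguments.
Unset Strict Implicit.
Unset Printing Implicit Defensive.
Import Order.TTheory GRing.Theory Num.Theory.
Import numFieldNormedType.Exports.
Local Open Scope classical_set_scope.
Local Open Scope ring_scope.

(** * Layer-cake formula for [Top] and a restricted Tonelli theorem *)

(** In a nonincreasing list the entries above [t] form a prefix, so cutting the list at length [l]
    only caps their number. *)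
Lemma count_gt_take_sorted (disp : Order.disp_t) (T : orderType disp)
    (t : T) (s : seq T) (l : nat) :
  sorted >=%O s ->
  count (fun y => t < y)%O (take l s) = minn l (count (fun y => t < y)%O s).
Proof.
elim: s l => [|x s IHs] [|l] //=; rewrite ?minn0 ?min0n // => xs.
have [tx|xt] := ltP t x; first by rewrite !add1n minnSS IHs// (path_sorted xs).
(* Once the head is at most [t], so is every later entry. The claim is made for any [r] inside [s]
   because it serves both [s] and a prefix of [s]. *)
have count0 (r : seq T) : {subset r <= s} -> count (fun y => t < y)%O r = 0%N.
  move=> rs; apply/eqP; rewrite -[_ == _]negbK -lt0n -has_count.
  apply/hasPn => y /rs ys; rewrite -leNgt (le_trans _ xt)//.
  move: xs; rewrite path_sortedE => [/andP[/allP + _]|? ? ? /[swap]].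
    exact.
  exact: le_trans.
by rewrite !add0n !count0 ?minn0// => y /mem_take.
Qed.

Lemma Ngt_count (R : realType) (m : nat) (t : R) (x : 'I_m -> R) :
  Ngt t x = count (fun y => t < y) [seq x i | i <- enum 'I_m].
Proof. by rewrite /Ngt cardsE cardE count_map size_filter enumT; exact: eq_count. Qed.

(** The count is a sum of indicators of []-oo, y[], and on the half-line each integrates to the
    length of [[0, y[], which is [y] because [y] is nonnegative. *)
Lemma integral_count_gt (R : realType) (s : seq R) :
  {in s, forall y, 0 <= y} ->
  (\int[@lebesgue_measure R]_(t in `[0%R, +oo[)
     (count (fun y => t < y)%R s)%:R%:E = (\sum_(y <- s) y)%:E)%E.
Proof.
move=> s0.
have countE (t : R) : ((count (fun y => t < y) s)%:R : R)%:E =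
    (\sum_(y <- s) (\1_(`]-oo, y[) t)%:E)%E.
  rewrite sumEFin -sum1_count natr_sum big_mkcond; congr _%:E; apply: eq_bigr => y _.
  by rewrite indicE mem_setE in_itv/=; case: ltP.
under eq_integral do rewrite countE.
rewrite ge0_integral_sum//=; last first.
  by move=> y; apply/measurable_EFinP; exact: measurable_indic.
rewrite -sumEFin big_seq [RHS]big_seq; apply: eq_bigr => y ys.
rewrite integral_indic// (_ : _ `&` _ = `[0, y[%classic).
  rewrite /= lebesgue_measure_itv/= lte_fin; case: ltP => [y0|y0]; first by rewrite oppr0 adde0.
  by congr _%:E; apply/eqP; rewrite eq_le s0.
apply/seteqP; split => t /=; rewrite !in_itv/= ?andbT; last by case/andP.
by case=> ? ?; apply/andP.
Qed.

Lemma Top_layer_cake (R : realType) (m l : nat) (x : 'I_m -> R) :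
  (forall i, 0 <= x i) ->
  (\int[@lebesgue_measure R]_(t in `[0%R, +oo[) (minn l (Ngt t x))%:R%:E =
   (Top l x)%:E)%E.
Proof.
move=> x0; rewrite /Top -integral_count_gt.
  apply: eq_integral => t _; rewrite count_gt_take_sorted; last first.
    by apply: sort_sorted => a b; rewrite le_total.
  by rewrite Ngt_count (permP (permEl (perm_sort _ _))).
by move=> y /mem_take; rewrite mem_sort => /mapP[i _ ->].
Qed.

(** Extending [f] by zero outside [setT * D] reduces this to Tonelli on the whole product. *)
Lemma fubini_tonelli_in (d1 d2 : measure_display) (T1 : measurableType d1)
    (T2 : measurableType d2) (R : realType)
    (m1 : {sigma_finite_measure set T1 -> \bar R})
    (m2 : {sigma_finite_measure set T2 -> \bar R}) (D : set T2)
    (f : T1 * T2 -> \bar R) :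
  measurable D -> measurable_fun setT f -> (forall z, 0 <= f z)%E ->
  (\int[m1]_x \int[m2]_(y in D) f (x, y) =
   \int[m2]_(y in D) \int[m1]_x f (x, y))%E.
Proof.
move=> mD mf f0; pose g := f \_ (setT `*` D).
have gE x y : g (x, y) = ((fun y => f (x, y)) \_ D) y.
  by rewrite /g !patchE in_setX in_setT.
under eq_integral do rewrite integral_mkcond.
under eq_integral do under eq_integral do rewrite -gE.
rewrite [RHS]integral_mkcond (fubini_tonelli g)//.
- apply: eq_integral => y _; rewrite patchE.
  under eq_integral do rewrite gE patchE.
  by case: ifP => // _; rewrite integral0.
- apply/(measurable_restrictT _ _).1; first exact: measurableX.
  exact: measurable_funS mf.
- by move=> z; rewrite /g patchE; case: ifP.
Qed.

(** * Comparing [min l (E N)] with [E (min l N)] for a sum [N] of indicators *)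

(** The bound holds with either argument in place of the minimum: with [x] since [a <= 1], and with
    [l] since the coefficient of [x ^+ 2] completes the square. *)
Lemma le_min_sqr (R : realFieldType) (a l x : R) :
  0 <= a <= 1 -> 0 < l -> 0 <= x ->
  a * x <= Num.min l x + a ^+ 2 / (4 * l) * x ^+ 2.
Proof.
move=> /andP[a0 a1] l0 x0.
have c0 : 0 <= a ^+ 2 / (4 * l) * x ^+ 2.
  by rewrite mulr_ge0 ?sqr_ge0// divr_ge0 ?sqr_ge0// mulr_ge0// ltW.
rewrite /Num.min; case: ifP => _; last first.
  by rewrite ler_wpDr// ler_piMl.
rewrite -subr_ge0.
have -> : l + a ^+ 2 / (4 * l) * x ^+ 2 - a * x =
    (2 * l - a * x) ^+ 2 / (4 * l).
  by field; rewrite gt_eqF.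
by rewrite divr_ge0 ?sqr_ge0// mulr_ge0// ltW.
Qed.

Lemma integral_sum_indic (R : realType) (d : measure_display)
    (T : measurableType d) (P : probability T R) (I : finType)
    (A : I -> set T) :
  (forall i, measurable (A i)) ->
  (\int[P]_w (\sum_i \1_(A i) w)%:E = (\sum_i fine (P (A i)))%:E)%E.
Proof.
move=> mA; under eq_integral do rewrite -sumEFin.
rewrite ge0_integral_sum//; last first.
  by move=> i; apply/measurable_EFinP; exact: measurable_indic.
rewrite -sumEFin; apply: eq_bigr => i _.
by rewrite integral_indic// setIT fineK// fin_num_measure.
Qed.

(** Expand the square over pairs. Diagonal terms give the mean, since an indicator is its own
    square. Off-diagonal terms factor, and adding the missing nonnegative diagonal products
    completes the squared mean. *)
Lemma integral_sqr_sum_indic_le (R : realType) (d : measure_display)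
    (T : measurableType d) (P : probability T R) (I : finType)
    (A : I -> set T) :
  (forall i, measurable (A i)) ->
  (forall i j, i != j -> P (A i `&` A j) = (P (A i) * P (A j))%E) ->
  (\int[P]_w ((\sum_i \1_(A i) w) ^+ 2)%:E <=
   (\sum_i fine (P (A i)) + (\sum_i fine (P (A i))) ^+ 2)%:E)%E.
Proof.
move=> mA indA.
have mAA (k : I * I) : measurable (A k.1 `&` A k.2) by exact: measurableI.
have sqrE w : (\sum_i \1_(A i) w : R) ^+ 2 =
    \sum_(k : I * I) \1_(A k.1 `&` A k.2) w.
  rewrite -(pair_bigA _ (fun i j => \1_(A i `&` A j) w))/= expr2 mulr_suml.
  apply: eq_bigr => i _; rewrite mulr_sumr; apply: eq_bigr => j _.
  by rewrite indicI.
under eq_integral do rewrite sqrE.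
rewrite integral_sum_indic// lee_fin.
rewrite -(pair_bigA _ (fun i j => fine (P (A i `&` A j))))/=.
rewrite expr2 mulr_suml -big_split/=; apply: ler_sum => i _.
rewrite (bigD1 i)//= setIid; apply: lerD => //.
rewrite mulr_sumr [leRHS](bigD1 i)//= ler_wpDl ?mulr_ge0 ?fine_ge0//.
by apply: ler_sum => j ji; rewrite indA 1?eq_sym// fineM ?fin_num_measure.
Qed.

(** A converse to Jensen up to a factor 2: the second moment bound keeps the sum from concentrating
    its mean on rare large values, which truncation at [l] would lose. *)
Lemma min_mean_le_mean_min (R : realType) (d : measure_display)
    (T : measurableType d) (P : probability T R) (I : finType)
    (A : I -> set T) (l : R) :
  1 <= l -> (forall i, measurable (A i)) ->
  (forall i j, i != j -> P (A i `&` A j) = (P (A i) * P (A j))%E) ->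
  ((Num.min l (\sum_i fine (P (A i))))%:E <=
   2%:E * \int[P]_w (Num.min l (\sum_i \1_(A i) w))%:E)%E.
Proof.
move=> l1 mA indA; have l0 : 0 < l by exact: lt_le_trans l1.
have S0 w : 0 <= \sum_i \1_(A i) w :> R by exact: sumr_ge0.
have mS : measurable_fun setT (fun w => \sum_i \1_(A i) w : R).
  by apply: measurable_sum => i; exact: measurable_indic.
have min0 w : 0 <= Num.min l (\sum_i \1_(A i) w) by rewrite le_min S0 ltW.
have mmin : measurable_fun setT (fun w => Num.min l (\sum_i \1_(A i) w)).
  by apply: measurable_minr => //; exact: measurable_cst.
have := integral_sum_indic P mA; have := integral_sqr_sum_indic_le mA indA.
set mu := \sum_i fine _; move=> ES2 ES.
set M := (\int[P]_w _)%E.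
have M0 : (0 <= M)%E by apply: integral_ge0 => w _; rewrite lee_fin.
have : 0 <= mu by apply: sumr_ge0 => i _; exact: fine_ge0.
(* The case [mu = 0] is split off because [a] divides by [mu]. *)
rewrite le_eqVlt => /predU1P[<-|mu0].
  by rewrite min_r ?(ltW l0)// mule_ge0.
(* The slope [a] makes the linear term have mean [a * mu = t]; [c] is the coefficient from
   [le_min_sqr]. *)
pose t := Num.min l mu; pose a := t / mu; pose c := a ^+ 2 / (4 * l).
have t0 : 0 < t by rewrite lt_min l0.
have a01 : 0 <= a <= 1.
  rewrite divr_ge0 ?(ltW t0) ?(ltW mu0)//= ler_pdivrMr// mul1r.
  by rewrite ge_min lexx orbT.
have c0 : 0 <= c by rewrite divr_ge0 ?sqr_ge0// mulr_ge0// ltW.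
(* The quadratic term stays on the right, so that only nonnegative functions are integrated. *)
have tM : (t%:E <= M + (c * (mu + mu ^+ 2))%:E)%E.
  apply: (@le_trans _ _ (M + \int[P]_w (c * (\sum_i \1_(A i) w) ^+ 2)%:E)%E);
    last first.
    apply: leeD => //; under eq_integral do rewrite EFinM.
    rewrite ge0_integralZl_EFin//; last 2 first.
    - by move=> w _; rewrite lee_fin sqr_ge0.
    - by apply/measurable_EFinP; exact: measurable_funX.
    by rewrite (EFinM c) lee_wpmul2l// lee_fin.
  have mcS : measurable_fun setT (fun w => c * (\sum_i \1_(A i) w) ^+ 2).
    by apply: measurable_funM => //; exact: measurable_funX.
  rewrite -ge0_integralD//; first last.
  - exact/measurable_EFinP.
  - by move=> w _; rewrite lee_fin mulr_ge0 ?sqr_ge0.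
  - exact/measurable_EFinP.
  - by move=> w _; rewrite lee_fin.
  have -> : t%:E = (\int[P]_w (a * \sum_i \1_(A i) w)%:E)%E.
    under eq_integral do rewrite EFinM.
    rewrite ge0_integralZl_EFin ?ES -?EFinM ?divfK ?gt_eqF//.
    + by move=> w _; rewrite lee_fin.
    + exact/measurable_EFinP.
    + by case/andP: a01.
  apply: ge0_le_integral => //.
  - by move=> w _; rewrite lee_fin mulr_ge0//; case/andP: a01.
  - by apply/measurable_EFinP; exact: measurable_funM.
  - by apply: emeasurable_funD; exact/measurable_EFinP.
  - by move=> w _; rewrite -EFinD lee_fin le_min_sqr.
(* Since [a * mu = t], the left side is [t / 4 * (a / l + t / l)]. Both fractions are at most 1, by
   [a <= 1 <= l] and [t <= l]. *)
have ct : c * (mu + mu ^+ 2) <= t / 2.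
  have tl : t / l <= 1 by rewrite ler_pdivrMr// mul1r ge_min lexx.
  have a1 : a / l <= 1.
    by rewrite ler_pdivrMr// mul1r (le_trans _ l1)//; case/andP: a01.
  have -> : c * (mu + mu ^+ 2) = t / 4 * (a / l + t / l).
    by rewrite /c /a; field; rewrite !gt_eqF.
  have : t / 4 * (a / l + t / l) <= t / 4 * (1 + 1).
    by rewrite ler_wpM2l ?divr_ge0 ?(ltW t0)// lerD.
  lra.
(* For finite [M], [t <= M + t / 2] gives [t <= 2 * M]; for infinite [M] the bound is trivial. *)
rewrite -/t; case: M M0 tM => [M| |]// _; last by rewrite gt0_muley ?lte_fin// leey.
rewrite -EFinD -EFinM !lee_fin; lra.
Qed.

(** This case of Jensen is monotonicity used twice: the integrand is at most the constant [l], of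
    integral [l] under a probability, and at most the sum itself. *)
Lemma mean_min_le_min_mean (R : realType) (d : measure_display)
    (T : measurableType d) (P : probability T R) (I : finType)
    (A : I -> set T) (l : R) :
  0 <= l -> (forall i, measurable (A i)) ->
  (\int[P]_w (Num.min l (\sum_i \1_(A i) w))%:E <=
   (Num.min l (\sum_i fine (P (A i))))%:E)%E.
Proof.
move=> l0 mA.
have S0 w : 0 <= \sum_i \1_(A i) w :> R by exact: sumr_ge0.
have mS : measurable_fun setT (fun w => \sum_i \1_(A i) w : R).
  by apply: measurable_sum => i; exact: measurable_indic.
have min0 w : setT w -> (0 <= (Num.min l (\sum_i \1_(A i) w))%:E)%E.
  by move=> _; rewrite lee_fin le_min S0 l0.
have mmin : measurable_fun setT (fun w => (Num.min l (\sum_i \1_(A i) w))%:E).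
  apply/measurable_EFinP; apply: measurable_minr => //; exact: measurable_cst.
rewrite EFin_min le_min; apply/andP; split.
  have -> : l%:E = (\int[P]_w (cst l%:E) w)%E.
    by rewrite integral_cst//= probability_setT mule1.
  by apply: ge0_le_integral => // w _; rewrite lee_fin ge_min lexx.
rewrite -integral_sum_indic//; apply: ge0_le_integral => //.
- by apply/measurable_EFinP.
- by move=> w _; rewrite lee_fin ge_min lexx orbT.
Qed.

(** * Counts above a threshold: measurability, means and independence *)

Section threshold_counts.
Context (R : realType) (d : measure_display) (T : measurableType d)
  (P : probability T R) (m : nat) (Y : 'I_m -> {RV P >-> R}).

(** Joint measurability in outcome and threshold, which the exchange of integrals requires. *)
Let mgt (i : 'I_m) : measurable [set z : T * R | z.2 < Y i z.1].
Proof.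
rewrite (_ : mkset _ = (fun z : T * R => z.2 < Y i z.1) @^-1` [set true])//.
rewrite -[_ @^-1` _]setTI; apply: measurable_fun_ltr => //.
exact: measurableT_comp.
Qed.

Let mem_preimage_gt (t : R) (i : 'I_m) (w : T) :
  (w \in Y i @^-1` `]t, +oo[) = (t < Y i w).
Proof. by apply/idP/idP; rewrite inE/= in_itv/= andbT. Qed.

Lemma Ngt_indic (t : R) (w : T) :
  (Ngt t (fun i => Y i w))%:R = \sum_i \1_(Y i @^-1` `]t, +oo[) w :> R.
Proof.
rewrite /Ngt cardsE -sum1_card natr_sum big_mkcond; apply: eq_bigr => i _.
rewrite indicE mem_preimage_gt [i \in _](_ : _ = (t < Y i w))//.
by case: ifP.
Qed.

Lemma measurable_Ngt :
  measurable_fun setT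
    (fun z : T * R => (Ngt z.2 (fun i => Y i z.1))%:R : R).
Proof.
rewrite (_ : (fun _ => _) =
    (fun z => \sum_i \1_[set z : T * R | z.2 < Y i z.1] z)).
  by apply: measurable_sum => i; exact: measurable_indic.
apply/funext => z; rewrite Ngt_indic; apply: eq_bigr => i _.
rewrite !indicE mem_preimage_gt; congr (nat_of_bool _)%:R.
by apply/idP/idP; rewrite inE.
Qed.

Lemma measurable_minn_Ngt (l : nat) :
  measurable_fun setT
    (fun z : T * R => (minn l (Ngt z.2 (fun i => Y i z.1)))%:R : R).
Proof.
under eq_fun do rewrite natr_min.
by apply: measurable_minr => //; exact: measurable_Ngt.
Qed.

Lemma expectation_Ngt (t : R) :
  ('E_P[fun w => (Ngt t (fun i => Y i w))%:R] =
   (\sum_i fine (P (Y i @^-1` `]t, +oo[)))%:E)%E.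
Proof.
rewrite unlock; under eq_integral do rewrite Ngt_indic.
rewrite integral_sum_indic// => i.
by rewrite -[_ @^-1` _]setTI; exact: measurable_funP.
Qed.

(** Layer cake inside the expectation, then Tonelli; both sides may be [+oo]. *)
Lemma expectation_Top (l : nat) :
  (forall i w, 0 <= Y i w) ->
  ('E_P[fun w => Top l (fun i => Y i w)] =
   \int[@lebesgue_measure R]_(t in `[0%R, +oo[)
     \int[P]_w (minn l (Ngt t (fun i => Y i w)))%:R%:E)%E.
Proof.
move=> Y0; rewrite unlock.
under eq_integral do rewrite -Top_layer_cake//.
rewrite (fubini_tonelli_in P (@lebesgue_measure R)
  (f := fun z => (minn l (Ngt z.2 (fun i => Y i z.1)))%:R%:E))//.
by apply/measurable_EFinP; exact: measurable_minn_Ngt.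
Qed.

(** Mutual independence for the index set [{i, j}], with the same half-line for every coordinate. *)
Lemma independent_RVs_gt (t : R) (i j : 'I_m) :
  independent_RVs Y -> i != j ->
  P (Y i @^-1` `]t, +oo[ `&` Y j @^-1` `]t, +oo[) =
  (P (Y i @^-1` `]t, +oo[) * P (Y j @^-1` `]t, +oo[))%E.
Proof.
move=> indY ij; have := indY [set i; j]%SET (fun=> `]t, +oo[%classic).
rewrite (big_setU1 _)/= ?inE// big_set1 => <-//; congr (P _).
apply/seteqP; split => w /=.
  by move=> [? ?] k; rewrite !inE => /orP[] /eqP ->.
by move=> h; split; apply: h; rewrite !inE eqxx ?orbT.
Qed.

End threshold_counts.

(** * Integrating the comparison at each threshold *)

Theorem theorem4p3 (R : realType) (d : measure_display)
    (T : measurableType d) (P : probability T R) (m : nat)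
    (Y : 'I_m -> {RV P >-> R})
    (Y_indep : independent_RVs Y)
    (Y_ge0 : forall (i : 'I_m) (w : T), 0 <= Y i w)
    (l : nat) (l_ge1 : (1 <= l)%N) (l_le_m : (l <= m)%N) :
  ('E_P[(fun w => Top l (fun i => Y i w))] <= gamma Y l)%E /\
  (gamma Y l <= 4%:R%:E * 'E_P[(fun w => Top l (fun i => Y i w))])%E.
Proof.
pose A t i := Y i @^-1` `]t, +oo[.
have mA t i : measurable (A t i).
  by rewrite -[A t i]setTI; exact: measurable_funP.
(* With [N] the count above [t], [g t] is [E (min l N)] and [h t] is [min l (E N)]; their integrals
   are the expectation of [Top] and [gamma]. *)
pose g t := (\int[P]_w (minn l (Ngt t (fun i => Y i w)))%:R%:E)%E.
pose h t := (Num.min l%:R (\sum_i fine (P (A t i))))%:E.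
have gE t : g t = (\int[P]_w (Num.min l%:R (\sum_i \1_(A t i) w))%:E)%E.
  by apply: eq_integral => w _; rewrite natr_min Ngt_indic.
have g0 t : (0 <= g t)%E by apply: integral_ge0 => w _; rewrite lee_fin.
have h0 t : (0 <= h t)%E.
  by rewrite lee_fin le_min ler0n/= sumr_ge0// => i _; exact: fine_ge0.
have mg : measurable_fun setT g.
  apply: (measurable_fun_fubini_tonelli_G
    (fun z => (minn l (Ngt z.2 (fun i => Y i z.1)))%:R%:E)) => //.
  by apply/measurable_EFinP; exact: measurable_minn_Ngt.
have mh : measurable_fun setT h.
  apply/measurable_EFinP; apply: measurable_minr; first exact: measurable_cst.
  apply/measurable_EFinP.
  (* The mean is rewritten as the inner integral of a jointly measurable function, so that Tonelli
     gives its measurability in [t]. *)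
  rewrite (_ : _ \o _ = fun t => (\int[P]_w (Ngt t (Y^~ w))%:R%:E)%E);
    last first.
    by apply/funext => t /=; rewrite -expectation_Ngt unlock.
  apply: (measurable_fun_fubini_tonelli_G
    (fun z => (Ngt z.2 (fun i => Y i z.1))%:R%:E)) => //.
  by apply/measurable_EFinP; exact: measurable_Ngt.
have mD : measurable (`[0, +oo[ : set R) by [].
have gammaE : gamma Y l = (\int[@lebesgue_measure R]_(t in `[0%R, +oo[) h t)%E.
  by apply: eq_integral => t _; rewrite expectation_Ngt /h EFin_min.
have TopE : ('E_P[fun w => Top l (fun i => Y i w)] =
    \int[@lebesgue_measure R]_(t in `[0%R, +oo[) g t)%E by exact: expectation_Top.
rewrite gammaE TopE; split.
  apply: ge0_le_integral => //;
    [exact: measurable_funTS|exact: measurable_funTS|move=> t _].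
  by rewrite gE; exact: mean_min_le_min_mean.
rewrite -ge0_integralZl_EFin//; last exact: measurable_funTS.
apply: ge0_le_integral => //.
- exact: measurable_funTS.
- by apply: emeasurable_funM => //; exact: measurable_funTS.
(* At each threshold the bound is proved with factor 2, then relaxed to 4 as [g t] is
   nonnegative. *)
- move=> t _; apply: (@le_trans _ _ (2%:E * g t)%E).
    rewrite gE; apply: min_mean_le_mean_min => //; first by rewrite ler1n.
    by move=> i j ij; exact: independent_RVs_gt.
  by rewrite lee_wpmul2r// lee_fin ler_nat.
Qed.
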